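(* Let $(A,M,\alpha\colon M\to A)$ be a $\delta_{\log}$-ring with $M$ integral, and suppose that the Jacobson radical $\mathrm{rad}(A)$ contains $p$. Then there exists a unique map $\delta_{\log}\colon M^{\mathrm{gp}}\to A$, extending the given $\delta_{\log}\colon M\to A$, satisfying $$\delta_{\log}(mm')=\delta_{\log}(m)+\delta_{\log}(m')+p\,\delta_{\log}(m)\delta_{\log}(m')\qquad(m,m'\in M^{\mathrm{gp}}).$$ Moreover, for any submonoid $N\subset M^{\mathrm{gp}}$ containing $M$, there exists a unique $\delta$-structure on $A\otimes_{\mathbb Z_{(p)}[M]}\mathbb Z_{(p)}[N]$ making $(A\otimes_{\mathbb Z_{(p)}[M]}\mathbb Z_{(p)}[N],N)$ a $\delta_{\log}$-ring over $(A,M)$, with $\delta_{\log}$ on $N$ the restriction to $N$ of the unique extended map $\delta_{\log}\colon M^{\mathrm{gp}}\to A$ (composed with $A\to A\otimes_{\mathbb Z_{(p)}[M]}\mathbb Z_{(p)}[N]$). The map $$(A,M)\to(A\otimes_{\mathbb Z_{(p)}[M]}\mathbb Z_{(p)}[N],N)$$ is universal among maps of $\delta_{\log}$-rings $(A,M)\to(B,N)$ compatible with the inclusion $M\subset N$ (i.e. whose monoid part is this inclusion). The construction of this universal map commutes with base changes $A\to A'$.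
   Context: Fix a prime $p$; all rings are $\mathbb Z_{(p)}$-algebras. Monoids are commutative with unit $e$; $M^{\mathrm{gp}}$ is the group completion and $M$ is integral if $M\to M^{\mathrm{gp}}$ is injective. A $\delta$-ring is a ring $A$ with a map $\delta\colon A\to A$ satisfying $\delta(0)=\delta(1)=0$, $\delta(xy)=\delta(x)y^p+x^p\delta(y)+p\delta(x)\delta(y)$, $\delta(x+y)=\delta(x)+\delta(y)-\sum_{i=1}^{p-1}\frac{(p-1)!}{i!(p-i)!}x^iy^{p-i}$. A prelog structure on $A$ is a monoid map $\alpha\colon M\to(A,\cdot)$. A $\delta_{\log}$-ring is a tuple $(A,\delta,\alpha\colon M\to A,\delta_{\log}\colon M\to A)$, abbreviated $(A,M)$, where $(A,\delta)$ is a $\delta$-ring, $\alpha$ a prelog structure and $\delta_{\log}$ a map with $\delta_{\log}(e)=0$, $\alpha(m)^p\delta_{\log}(m)=\delta(\alpha(m))$ and $\delta_{\log}(mm')=\delta_{\log}(m)+\delta_{\log}(m')+p\delta_{\log}(m)\delta_{\log}(m')$. Morphisms are morphisms of prelog rings (compatible pairs of a ring map and a monoid map) compatible with $\delta$ and $\delta_{\log}$. Base change along a map of $\delta$-rings $A\to A'$ (with $p\in\mathrm{rad}(A')$): $(A',M)$ is a $\delta_{\log}$-ring via composition with $A\to A'$. *)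

(* Defs.v *)
From HB Require Import structures.
From mathcomp Require Import all_boot all_algebra.
From mathcomp Require Import finmap boolp.
From mathcomp.multinomials Require Import monalg.

Set Implicit Arguments.
Unset Strict Implicit.
Unset Printing Implicit Defensive.

Import GRing.Theory.
Local Open Scope ring_scope.
Local Open Scope quotient_scope.

(* Conventions.  A commutative monoid is an [nmodType], written additively:
   its unit e is [0] and its law is [+].  A monoid map is an [{additive _ -> _}].
   Rings are [comPzRingType]s: the zero ring is allowed, and it does occur, since
   the base change of a nonzero ring to a localised monoid ring can vanish. *)

Section GroupCompletion.
Variable M : nmodType.

Definition gp_rel (x y : M * M) : bool :=
  `[< exists k, x.1 + y.2 + k = y.1 + x.2 + k >].

Lemma gp_rel_refl : reflexive gp_rel.
Proof. by move=> x; apply/asboolP; exists 0. Qed.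

Lemma gp_rel_sym : symmetric gp_rel.
Proof.
by move=> x y; apply/asboolP/asboolP => -[k e]; exists k; rewrite e.
Qed.

Lemma gp_rel_trans : transitive gp_rel.
Proof.
move=> y x z /asboolP[k e] /asboolP[l e']; apply/asboolP.
exists (y.1 + y.2 + k + l).
have -> : x.1 + z.2 + (y.1 + y.2 + k + l) =
          (x.1 + y.2 + k) + (y.1 + z.2 + l).
  by rewrite (AC (2*4) ((1*4*5)*(3*2*6))).
rewrite e e'.
by rewrite (AC (3*3) ((4*2)*(1*5*3*6))).
Qed.

Canonical gp_equiv := EquivRel gp_rel gp_rel_refl gp_rel_sym gp_rel_trans.

Definition gp := {eq_quot gp_rel}.
HB.instance Definition _ : EqQuotient _ gp_rel gp := EqQuotient.on gp.
HB.instance Definition _ := Choice.on gp.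

Lemma gp_eq (x y : M * M) :
  \pi_gp x = \pi_gp y <-> exists k, x.1 + y.2 + k = y.1 + x.2 + k.
Proof.
have -> : (\pi_gp x = \pi_gp y) <-> gp_rel x y.
  by split=> [/eqP|e]; [|apply/eqP]; rewrite eqmodE.
by split=> [/asboolP|e]; [|apply/asboolP].
Qed.

Definition gp_zero : gp := \pi_gp 0.
Definition gp_opp (x : gp) : gp := \pi_gp ((repr x).2, (repr x).1).
Definition gp_add (x y : gp) : gp := \pi_gp (repr x + repr y).

Lemma gp_oppE (x : M * M) : gp_opp (\pi_gp x) = \pi_gp (x.2, x.1).
Proof.
have /gp_eq[k e] := reprK (\pi_gp x : gp).
by apply/gp_eq; exists k => /=; rewrite [_.2 + x.1]addrC [x.2 + _]addrC -e.
Qed.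

Lemma gp_addE (x y : M * M) : gp_add (\pi_gp x) (\pi_gp y) = \pi_gp (x + y).
Proof.
have /gp_eq[k e] := reprK (\pi_gp x : gp).
have /gp_eq[l e'] := reprK (\pi_gp y : gp).
apply/gp_eq; exists (k + l) => /=.
have ac (a b c d u v : M) : a + b + (c + d) + (u + v) = a + c + u + (b + d + v).
  by rewrite (AC (2*2*2) ((1*3*5)*(2*4*6))).
by rewrite !ac e e'.
Qed.

Lemma gp_addA : associative gp_add.
Proof.
elim/quotW=> x; elim/quotW=> y; elim/quotW=> z.
by rewrite (gp_addE y z) (gp_addE x y) (gp_addE x) (gp_addE (x + y)) addrA.
Qed.

Lemma gp_addC : commutative gp_add.
Proof. by elim/quotW=> x; elim/quotW=> y; rewrite (gp_addE x y) (gp_addE y x) addrC. Qed.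

Lemma gp_add0 : left_id gp_zero gp_add.
Proof. by elim/quotW=> x; rewrite (gp_addE 0 x) add0r. Qed.

Lemma gp_addN : left_inverse gp_zero gp_opp gp_add.
Proof.
elim/quotW=> x; rewrite gp_oppE gp_addE; apply/gp_eq; exists 0 => /=.
by rewrite !addr0 add0r addrC.
Qed.

HB.instance Definition _ :=
  GRing.isZmodule.Build gp gp_addA gp_addC gp_add0 gp_addN.

Definition to_gp (m : M) : gp := \pi_gp (m, 0).

Lemma to_gp_is_nmod_morphism : nmod_morphism to_gp.
Proof.
split=> // x y; rewrite /to_gp.
by apply: etrans (esym (gp_addE _ _)); congr \pi_gp; congr pair; rewrite addr0.
Qed.

HB.instance Definition _ :=
  GRing.isNmodMorphism.Build M gp to_gp to_gp_is_nmod_morphism.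

Definition integral_monoid : Prop := injective to_gp.

End GroupCompletion.

Definition submonoid (V : nmodType) (N : addrClosed V) := {x : V | x \in N}.

HB.instance Definition _ (V : nmodType) (N : addrClosed V) :=
  SubChoice.on (submonoid N).

Lemma submonoid_closed (V : nmodType) (N : addrClosed V) :
  addr_closed (fun x : V => x \in N).
Proof. by split=> [|x y]; [exact: rpred0 | exact: rpredD]. Qed.

HB.instance Definition _ (V : nmodType) (N : addrClosed V) :=
  GRing.SubChoice_isSubNmodule.Build V _ (submonoid N) (submonoid_closed N).

Section SubmonoidInclusion.
Variables (M : nmodType) (N : addrClosed (gp M)).
Hypothesis sMN : forall m : M, to_gp m \in N.

Definition to_sub (m : M) : submonoid N := exist _ (to_gp m) (sMN m).

Lemma to_sub_is_nmod_morphism : nmod_morphism to_sub.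
Proof.
by split=> [|x y]; apply/val_inj; rewrite ?raddf0 // !raddfD /= raddfD.
Qed.

HB.instance Definition _ := GRing.isNmodMorphism.Build M (submonoid N) to_sub
  to_sub_is_nmod_morphism.

End SubmonoidInclusion.

Record prelog (M : nmodType) (A : pzSemiRingType) := Prelog {
  prelog_fun :> M -> A;
  prelog0 : prelog_fun 0 = 1;
  prelogD : {morph prelog_fun : m n / m + n >-> m * n}
}.

Section PrelogComp.
Variables (M : nmodType) (A B : pzSemiRingType).
Variables (f : {rmorphism A -> B}) (alpha : prelog M A).

Lemma prelog_comp0 : (f \o alpha) 0 = 1.
Proof. by rewrite /= prelog0 rmorph1. Qed.

Lemma prelog_compD : {morph f \o alpha : m n / m + n >-> m * n}.
Proof. by move=> m n; rewrite /= prelogD rmorphM. Qed.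

Definition prelog_comp : prelog M B := Prelog prelog_comp0 prelog_compD.

End PrelogComp.

(* [monalg] provides the additive group [{malg R[M]}] of finitely supported
   functions for every choice type, but its ring structure only for monoids
   without nontrivial units; hence the product is redefined here. *)

Section MalgSum.
Variables (K : choiceType) (G : zmodType).

Lemma malg_ind (P : {malg G[K]} -> Prop) :
  P 0 -> (forall g h, P g -> P h -> P (g + h)) ->
  (forall c k, P << c *g k >>) -> forall g, P g.
Proof. by move=> P0 PD PU g; rewrite [g]monalgE; apply: big_ind. Qed.

Variables (V : nmodType) (F : K -> G -> V).
Hypothesis F_add : forall k, nmod_morphism (F k).

Definition malg_sum (g : {malg G[K]}) : V := \sum_(k <- msupp g) F k g@_k.

Lemma malg_sumEw (d : {fset K}) g : (msupp g `<=` d)%fset ->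
  malg_sum g = \sum_(k <- d) F k g@_k.
Proof.
move=> le; rewrite [LHS](big_fset_incl _ le) => //= x xd /mcoeff_outdom ->.
by rewrite (F_add x).1.
Qed.

Lemma malg_sumU c k : malg_sum << c *g k >> = F k c.
Proof. by rewrite (malg_sumEw msuppU_le) big_seq_fset1 mcoeffUU. Qed.

Lemma malg_sum_is_nmod_morphism : nmod_morphism malg_sum.
Proof.
split=> [|g h]; first by rewrite /malg_sum msupp0 big_seq_fset0.
rewrite (malg_sumEw (msuppD_le g h)).
rewrite (malg_sumEw (fsubsetUl (msupp g) (msupp h))).
rewrite (malg_sumEw (fsubsetUr (msupp g) (msupp h))) -big_split /=.
by apply: eq_bigr => k _; rewrite mcoeffD (F_add k).2.
Qed.

End MalgSum.

Section MonoidAlgebra.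
Variables (R : comNzRingType) (M : nmodType).

Definition monoid_algebra := {malg R[M]}.
HB.instance Definition _ := GRing.Zmodule.on monoid_algebra.

Implicit Types (g h : monoid_algebra).

Definition monomial (c : R) (m : M) : monoid_algebra := << c *g m >>.

Definition ma_one : monoid_algebra := monomial 1 0.
Definition ma_mul g h : monoid_algebra :=
  malg_sum (fun k c => malg_sum (fun l d => monomial (c * d) (k + l)) h) g.

Lemma monomial_add m : nmod_morphism (monomial^~ m).
Proof. by split=> [|c d]; rewrite /monomial ?raddf0 ?raddfD. Qed.

Let inner_add (c : R) (k l : M) :
  nmod_morphism (fun d => monomial (c * d) (k + l)).
Proof.
by split=> [|d e]; rewrite ?mulr0 ?mulrDr; [exact: (monomial_add _).1
  |exact: (monomial_add _).2].
Qed.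

Let outer_add h (k : M) :
  nmod_morphism (fun c => malg_sum (fun l d => monomial (c * d) (k + l)) h).
Proof.
split=> [|c c']; rewrite /malg_sum.
  by apply: big1 => l _; rewrite mul0r (monomial_add _).1.
by rewrite -big_split; apply: eq_bigr => l _; rewrite mulrDl (monomial_add _).2.
Qed.

Lemma ma_mulUU c d k l :
  ma_mul (monomial c k) (monomial d l) = monomial (c * d) (k + l).
Proof. by rewrite /ma_mul malg_sumU ?malg_sumU. Qed.

Lemma ma_mulDl : left_distributive ma_mul +%R.
Proof.
by move=> g g' h; apply: (malg_sum_is_nmod_morphism (outer_add h)).2.
Qed.

Lemma ma_mulDr : right_distributive ma_mul +%R.
Proof.
move=> g h h'; rewrite /ma_mul /malg_sum -/(malg_sum _ _) -big_split.
apply: eq_bigr => k _.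
exact: (malg_sum_is_nmod_morphism (inner_add g@_k k)).2.
Qed.

Lemma ma_mul0 : right_zero 0 ma_mul.
Proof. by move=> g; apply: (addrI (ma_mul g 0)); rewrite -ma_mulDr !addr0. Qed.

Lemma ma_0mul : left_zero 0 ma_mul.
Proof. by move=> g; apply: (addrI (ma_mul 0 g)); rewrite -ma_mulDl !addr0. Qed.

Lemma ma_mulC : commutative ma_mul.
Proof.
move=> g h; elim/malg_ind: g => [|g g' e e'|c k].
- by rewrite ma_mul0 ma_0mul.
- by rewrite ma_mulDl ma_mulDr e e'.
elim/malg_ind: h => [|h h' e e'|d l].
- by rewrite ma_mul0 ma_0mul.
- by rewrite ma_mulDl ma_mulDr e e'.
by rewrite !ma_mulUU mulrC addrC.
Qed.

Lemma ma_mulA : associative ma_mul.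
Proof.
move=> g h x; elim/malg_ind: g => [|g g' e e'|c k].
- by rewrite !ma_0mul.
- by rewrite !ma_mulDl e e'.
elim/malg_ind: h => [|h h' e e'|d l].
- by rewrite ma_mul0 !ma_0mul ma_mul0.
- by rewrite ma_mulDl !ma_mulDr ma_mulDl e e'.
elim/malg_ind: x => [|x x' e e'|b n].
- by rewrite !ma_mul0.
- by rewrite !ma_mulDr e e'.
by rewrite !ma_mulUU mulrA addrA.
Qed.

Lemma ma_mul1 : left_id ma_one ma_mul.
Proof.
move=> g; elim/malg_ind: g => [|g g' e e'|c k].
- by rewrite ma_mul0.
- by rewrite ma_mulDr e e'.
by rewrite ma_mulUU mul1r add0r.
Qed.

HB.instance Definition _ := GRing.Zmodule_isComPzRing.Build monoid_algebra
  ma_mulA ma_mulC ma_mul1 ma_mulDl.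

Lemma ma_basis0 : monomial 1 0 = 1.
Proof. by []. Qed.

Lemma ma_basisD : {morph monomial 1 : m n / m + n >-> m * n}.
Proof.
by move=> m n; rewrite -[RHS]/(ma_mul _ _) ma_mulUU mulr1.
Qed.

Definition ma_basis : prelog M monoid_algebra := Prelog ma_basis0 ma_basisD.

Definition ma_const (c : R) : monoid_algebra := monomial c 0.

Lemma ma_const_is_nmod_morphism : nmod_morphism ma_const.
Proof. exact: monomial_add. Qed.

Lemma ma_const_is_monoid_morphism : monoid_morphism ma_const.
Proof.
by split=> // c d; rewrite -[RHS]/(ma_mul _ _) ma_mulUU addr0.
Qed.

HB.instance Definition _ := GRing.isNmodMorphism.Build R monoid_algebra ma_const
  ma_const_is_nmod_morphism.
HB.instance Definition _ := GRing.isMonoidMorphism.Build R monoid_algebra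
  ma_const ma_const_is_monoid_morphism.

End MonoidAlgebra.

Section MonoidAlgebraLift.
Variables (R : comNzRingType) (M : nmodType) (A : comPzRingType).
Variables (f : {rmorphism R -> A}) (alpha : prelog M A).

Definition ma_lift : monoid_algebra R M -> A :=
  malg_sum (fun m c => f c * alpha m).

Let lift_add (m : M) : nmod_morphism (fun c => f c * alpha m).
Proof. by split=> [|c d]; rewrite ?rmorph0 ?mul0r // rmorphD mulrDl. Qed.

Lemma ma_liftU c m : ma_lift (monomial c m) = f c * alpha m.
Proof. exact: malg_sumU. Qed.

Lemma ma_lift_is_nmod_morphism : nmod_morphism ma_lift.
Proof. exact: malg_sum_is_nmod_morphism. Qed.

HB.instance Definition _ := GRing.isNmodMorphism.Build
  (monoid_algebra R M) A ma_lift ma_lift_is_nmod_morphism.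

Lemma ma_lift_is_monoid_morphism : monoid_morphism ma_lift.
Proof.
split=> [|g h]; first by rewrite ma_liftU rmorph1 prelog0 mulr1.
elim/malg_ind: g => [|g g' e e'|c k].
- by rewrite mul0r raddf0 mul0r.
- by rewrite mulrDl !raddfD /= e e' mulrDl.
elim/malg_ind: h => [|h h' e e'|d l].
- by rewrite mulr0 raddf0 mulr0.
- by rewrite mulrDr !raddfD /= e e' mulrDr.
rewrite -[_ * _]/(ma_mul _ _) ma_mulUU !ma_liftU rmorphM prelogD.
by rewrite mulrACA.
Qed.

HB.instance Definition _ := GRing.isMonoidMorphism.Build
  (monoid_algebra R M) A ma_lift ma_lift_is_monoid_morphism.

End MonoidAlgebraLift.

Record ideal (A : comPzRingType) := Ideal {
  in_ideal :> A -> Prop;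
  ideal0 : in_ideal 0;
  idealD : forall x y, in_ideal x -> in_ideal y -> in_ideal (x + y);
  idealM : forall a x, in_ideal x -> in_ideal (a * x)
}.

Definition maximal_ideal (A : comPzRingType) (I : ideal A) : Prop :=
  ~ I 1 /\
  forall J : ideal A, ~ J 1 -> (forall x, I x -> J x) -> forall x, J x -> I x.

Definition jacobson_radical (A : comPzRingType) (x : A) : Prop :=
  forall I : ideal A, maximal_ideal I -> I x.

Section IdealGenerated.
Variables (A : comPzRingType) (S : A -> Prop).

Definition in_generated (x : A) : Prop :=
  forall I : ideal A, (forall s, S s -> I s) -> I x.

Lemma in_generated0 : in_generated 0.
Proof. by move=> I _; apply: ideal0. Qed.

Lemma in_generatedD x y :
  in_generated x -> in_generated y -> in_generated (x + y).
Proof. by move=> hx hy I hI; apply: idealD; [apply: hx | apply: hy]. Qed.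

Lemma in_generatedM a x : in_generated x -> in_generated (a * x).
Proof. by move=> hx I hI; apply/idealM/hx. Qed.

Definition ideal_generated : ideal A :=
  Ideal in_generated0 in_generatedD in_generatedM.

End IdealGenerated.

Section QuotientRing.
Variables (A : comPzRingType) (I : ideal A).

Lemma idealN x : I x -> I (- x).
Proof. by rewrite -mulN1r; apply: idealM. Qed.

Definition qr_rel (x y : A) : bool := `[< I (x - y) >].

Lemma qr_rel_refl : reflexive qr_rel.
Proof. by move=> x; apply/asboolP; rewrite subrr; apply: ideal0. Qed.

Lemma qr_rel_sym : symmetric qr_rel.
Proof.
by move=> x y; apply/asboolP/asboolP => /idealN; rewrite opprB.
Qed.

Lemma qr_rel_trans : transitive qr_rel.
Proof.
move=> y x z /asboolP hx /asboolP hy; apply/asboolP.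
by rewrite -(subrKA y); apply: idealD.
Qed.

Canonical qr_equiv := EquivRel qr_rel qr_rel_refl qr_rel_sym qr_rel_trans.

Definition quotient_ring := {eq_quot qr_rel}.
Local Notation Q := quotient_ring.
HB.instance Definition _ : EqQuotient _ qr_rel Q := EqQuotient.on Q.
HB.instance Definition _ := Choice.on Q.

Definition to_quotient (x : A) : Q := \pi_Q x.

Lemma to_quotient_eq (x y : A) : to_quotient x = to_quotient y <-> I (x - y).
Proof.
have -> : (to_quotient x = to_quotient y) <-> qr_rel x y.
  by split=> [/eqP|e]; [|apply/eqP]; rewrite eqmodE.
by split=> [/asboolP|e]; [|apply/asboolP].
Qed.

Lemma quotient_ind (P : Q -> Prop) : (forall x, P (to_quotient x)) -> forall x, P x.
Proof. by move=> h; elim/quotW. Qed.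

Lemma repr_quotient (x : A) : I (repr (to_quotient x) - x).
Proof. by apply/to_quotient_eq/reprK. Qed.

Definition qr_opp (x : Q) : Q := to_quotient (- repr x).
Definition qr_add (x y : Q) : Q := to_quotient (repr x + repr y).
Definition qr_mul (x y : Q) : Q := to_quotient (repr x * repr y).

Lemma qr_oppE x : qr_opp (to_quotient x) = to_quotient (- x).
Proof.
by apply/to_quotient_eq; rewrite -opprD; apply/idealN/repr_quotient.
Qed.

Lemma qr_addE x y :
  qr_add (to_quotient x) (to_quotient y) = to_quotient (x + y).
Proof.
by apply/to_quotient_eq; rewrite opprD addrACA; apply: idealD;
  apply: repr_quotient.
Qed.

Lemma qr_mulE x y :
  qr_mul (to_quotient x) (to_quotient y) = to_quotient (x * y).
Proof.
apply/to_quotient_eq; set x' := repr _; set y' := repr _.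
have -> : x' * y' - x * y = y' * (x' - x) + x * (y' - y).
  by rewrite !mulrBr addrA [y' * x']mulrC [y' * x]mulrC subrK.
by apply: idealD; apply/idealM/repr_quotient.
Qed.

Lemma qr_addA : associative qr_add.
Proof.
elim/quotient_ind=> x; elim/quotient_ind=> y; elim/quotient_ind=> z.
by rewrite (qr_addE y z) (qr_addE x y) (qr_addE x) (qr_addE (x + y)) addrA.
Qed.

Lemma qr_addC : commutative qr_add.
Proof.
elim/quotient_ind=> x; elim/quotient_ind=> y.
by rewrite (qr_addE x y) (qr_addE y x) addrC.
Qed.

Lemma qr_add0 : left_id (to_quotient 0) qr_add.
Proof. by elim/quotient_ind=> x; rewrite (qr_addE 0 x) add0r. Qed.

Lemma qr_addN : left_inverse (to_quotient 0) qr_opp qr_add.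
Proof.
by elim/quotient_ind=> x; rewrite (qr_oppE x) (qr_addE (- x) x) addNr.
Qed.

HB.instance Definition _ :=
  GRing.isZmodule.Build Q qr_addA qr_addC qr_add0 qr_addN.

Lemma qr_mulA : associative qr_mul.
Proof.
elim/quotient_ind=> x; elim/quotient_ind=> y; elim/quotient_ind=> z.
by rewrite (qr_mulE y z) (qr_mulE x y) (qr_mulE x) (qr_mulE (x * y)) mulrA.
Qed.

Lemma qr_mulC : commutative qr_mul.
Proof.
elim/quotient_ind=> x; elim/quotient_ind=> y.
by rewrite (qr_mulE x y) (qr_mulE y x) mulrC.
Qed.

Lemma qr_mul1 : left_id (to_quotient 1) qr_mul.
Proof. by elim/quotient_ind=> x; rewrite (qr_mulE 1 x) mul1r. Qed.

Lemma qr_mulDl : left_distributive qr_mul +%R.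
Proof.
elim/quotient_ind=> x; elim/quotient_ind=> y; elim/quotient_ind=> z.
rewrite -[_ + _ in LHS]/(qr_add _ _) -[RHS]/(qr_add _ _).
rewrite (qr_addE x y) (qr_mulE (x + y) z) (qr_mulE x z) (qr_mulE y z).
by rewrite (qr_addE (x * z)) mulrDl.
Qed.

HB.instance Definition _ := GRing.Zmodule_isComPzRing.Build Q
  qr_mulA qr_mulC qr_mul1 qr_mulDl.

Lemma to_quotient_is_nmod_morphism : nmod_morphism to_quotient.
Proof. by split=> // x y; rewrite -[RHS]/(qr_add _ _) (qr_addE x y). Qed.

Lemma to_quotient_is_monoid_morphism : monoid_morphism to_quotient.
Proof. by split=> // x y; rewrite -[RHS]/(qr_mul _ _) (qr_mulE x y). Qed.

HB.instance Definition _ := GRing.isNmodMorphism.Build A Q to_quotient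
  to_quotient_is_nmod_morphism.
HB.instance Definition _ := GRing.isMonoidMorphism.Build A Q to_quotient
  to_quotient_is_monoid_morphism.

End QuotientRing.

(* A commutative ring as a monoid under multiplication: [x + y] in
   [mul_monoid A] is the product of A, and [0] is the 1 of A. *)
Definition mul_monoid (A : comPzRingType) : Type := A.
HB.instance Definition _ (A : comPzRingType) := Choice.on (mul_monoid A).
HB.instance Definition _ (A : comPzRingType) :=
  GRing.isNmodule.Build (mul_monoid A) (@mulrA A) (@mulrC A) (@mul1r A).

(* The tensor product of A and B over R is the free abelian group Z[A x B] on the
   symbols [a, b], modulo the biadditivity and R-balancedness relations.  For the
   product [a, b][a', b'] = [aa', bb'] these relations are stable under
   multiplication by symbols, so that the subgroup they span is the ideal they
   generate. *)
Section Tensor.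
Variables (R A B : comPzRingType).
Variables (f : {rmorphism R -> A}) (g : {rmorphism R -> B}).

Local Notation free := (monoid_algebra int (mul_monoid A * mul_monoid B)%type).

Definition tensor_sym (a : A) (b : B) : free :=
  monomial 1 (a : mul_monoid A, b : mul_monoid B).

Inductive tensor_rel : free -> Prop :=
| TensorAddl a a' b :
    tensor_rel (tensor_sym (a + a') b - (tensor_sym a b + tensor_sym a' b))
| TensorAddr a b b' :
    tensor_rel (tensor_sym a (b + b') - (tensor_sym a b + tensor_sym a b'))
| TensorBal r a b :
    tensor_rel (tensor_sym (f r * a) b - tensor_sym a (g r * b)).

Definition tensor := quotient_ring (ideal_generated tensor_rel).
HB.instance Definition _ := GRing.ComPzRing.on tensor.

Definition tpure (a : A) (b : B) : tensor := to_quotient _ (tensor_sym a b).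

Lemma tensor_relP x y : tensor_rel (x - y) ->
  to_quotient (ideal_generated tensor_rel) x = to_quotient _ y.
Proof. by move=> h; apply/to_quotient_eq => I; apply. Qed.

Lemma tpureDl a a' b : tpure (a + a') b = tpure a b + tpure a' b.
Proof.
rewrite -[RHS](raddfD (to_quotient _)).
by apply: tensor_relP; apply: TensorAddl.
Qed.

Lemma tpureDr a b b' : tpure a (b + b') = tpure a b + tpure a b'.
Proof.
rewrite -[RHS](raddfD (to_quotient _)).
by apply: tensor_relP; apply: TensorAddr.
Qed.

Lemma tpureM a a' b b' : tpure a b * tpure a' b' = tpure (a * a') (b * b').
Proof.
rewrite -[LHS](rmorphM (to_quotient _)); congr to_quotient.
by rewrite -[LHS]/(ma_mul _ _) ma_mulUU mulr1.
Qed.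

Lemma tpureZ r a b : tpure (f r * a) b = tpure a (g r * b).
Proof. by apply: tensor_relP; apply: TensorBal. Qed.

Lemma tpure0l b : tpure 0 b = 0.
Proof. by apply: (addrI (tpure 0 b)); rewrite -tpureDl !addr0. Qed.

Lemma tpure0r a : tpure a 0 = 0.
Proof. by apply: (addrI (tpure a 0)); rewrite -tpureDr !addr0. Qed.

Definition tensor_inl (a : A) : tensor := tpure a 1.
Definition tensor_inr (b : B) : tensor := tpure 1 b.

Lemma tensor_inl_is_nmod_morphism : nmod_morphism tensor_inl.
Proof. by split=> [|a a']; [exact: tpure0l | exact: tpureDl]. Qed.

Lemma tensor_inl_is_monoid_morphism : monoid_morphism tensor_inl.
Proof. by split=> // a a'; rewrite /tensor_inl tpureM mulr1. Qed.

HB.instance Definition _ := GRing.isNmodMorphism.Build A tensor tensor_inl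
  tensor_inl_is_nmod_morphism.
HB.instance Definition _ := GRing.isMonoidMorphism.Build A tensor tensor_inl
  tensor_inl_is_monoid_morphism.

Lemma tensor_inr_is_nmod_morphism : nmod_morphism tensor_inr.
Proof. by split=> [|b b']; [exact: tpure0r | exact: tpureDr]. Qed.

Lemma tensor_inr_is_monoid_morphism : monoid_morphism tensor_inr.
Proof. by split=> // b b'; rewrite /tensor_inr tpureM mulr1. Qed.

HB.instance Definition _ := GRing.isNmodMorphism.Build B tensor tensor_inr
  tensor_inr_is_nmod_morphism.
HB.instance Definition _ := GRing.isMonoidMorphism.Build B tensor tensor_inr
  tensor_inr_is_monoid_morphism.

End Tensor.

Definition zloc_pred (p : nat) : {pred rat} := fun x => coprime p `|denq x|.

Lemma zloc_predP (p : nat) (x : rat) :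
  reflect (exists2 n : nat, coprime p n & exists m : int, x * n%:R = m%:~R)
          (x \in zloc_pred p).
Proof.
apply: (iffP idP) => [h|[n cpn [m e]]].
  exists `|denq x|%N => //; exists (numq x).
  by rewrite numqE pmulrn absz_denq.
have dvd : (denq x %| n%:Z)%Z.
  rewrite -(@Gauss_dvdzr _ (numq x)); last by rewrite coprimez_sym coprimezE coprime_num_den.
  apply/dvdzP; exists m; apply/eqP; rewrite -(eqr_int rat) !rmorphM /= numqE -e.
  by rewrite mulrAC.
by rewrite unfold_in; apply: coprime_dvdr cpn; move: dvd; rewrite dvdzE.
Qed.

Lemma zloc_subring_closed (p : nat) : subring_closed (zloc_pred p).
Proof.
split=> [|x y|x y].
- by rewrite unfold_in /zloc_pred coprimen1.
- move=> /zloc_predP[n cn [m e]] /zloc_predP[n' cn' [m' e']].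
  apply/zloc_predP; exists (n * n')%N; first by rewrite coprimeMr cn.
  exists (m * n'%:Z - m' * n%:Z); rewrite intrB !intrM -!pmulrn -e -e' natrM mulrBl.
  by rewrite !mulrA [in RHS](mulrAC y).
- move=> /zloc_predP[n cn [m e]] /zloc_predP[n' cn' [m' e']].
  apply/zloc_predP; exists (n * n')%N; first by rewrite coprimeMr cn.
  by exists (m * m'); rewrite intrM -e -e' natrM mulrACA.
Qed.

HB.instance Definition _ (p : nat) :=
  GRing.isSubringClosed.Build rat (zloc_pred p) (zloc_subring_closed p).

Definition zloc (p : nat) := {x : rat | x \in zloc_pred p}.
HB.instance Definition _ (p : nat) := SubChoice.on (zloc p).

Lemma zloc_closed (p : nat) : subring_closed (fun x : rat => x \in zloc_pred p).
Proof.
by split=> [|x y|x y]; [exact: rpred1 | exact: rpredB | exact: rpredM].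
Qed.

HB.instance Definition _ (p : nat) :=
  GRing.SubChoice_isSubComNzRing.Build rat _ (zloc p) (zloc_closed p).

(* A ring admits at most one ring map from Z_(p), so ring maps between
   Z_(p)-algebras are automatically Z_(p)-linear. *)
Record zlocAlg (p : nat) := ZlocAlg {
  zloc_alg_ring :> comPzRingType;
  zloc_alg_map : {rmorphism zloc p -> zloc_alg_ring}
}.

Definition tensor_alg (p : nat) (R : comPzRingType) (A : zlocAlg p)
    (B : comPzRingType) (f : {rmorphism R -> A}) (g : {rmorphism R -> B}) :
    zlocAlg p :=
  ZlocAlg (tensor_inl f g \o zloc_alg_map A).

(* In [deltaD] the division of factorials is exact when p is prime. *)
Record delta_structure (p : nat) (A : zlocAlg p) := DeltaStructure {
  delta_fun :> A -> A;
  delta0 : delta_fun 0 = 0;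
  delta1 : delta_fun 1 = 0;
  deltaM : forall x y, delta_fun (x * y) =
    delta_fun x * y ^+ p + x ^+ p * delta_fun y +
    p%:R * delta_fun x * delta_fun y;
  deltaD : forall x y, delta_fun (x + y) =
    delta_fun x + delta_fun y -
    \sum_(1 <= i < p)
      ((p.-1)`! %/ (i`! * (p - i)`!))%:R * x ^+ i * y ^+ (p - i)
}.

Record dlog_ring (p : nat) (A : zlocAlg p) (M : nmodType) := DlogRing {
  dlog_delta : delta_structure A;
  dlog_alpha : prelog M A;
  dlog_fun : M -> A;
  dlog0 : dlog_fun 0 = 0;
  dlog_alphaE : forall m,
    dlog_alpha m ^+ p * dlog_fun m = dlog_delta (dlog_alpha m);
  dlogD : forall m n, dlog_fun (m + n) =
    dlog_fun m + dlog_fun n + p%:R * dlog_fun m * dlog_fun n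
}.

Definition is_dlog_hom (p : nat) (A B : zlocAlg p) (M N : nmodType)
    (D : dlog_ring A M) (E : dlog_ring B N)
    (f : {rmorphism A -> B}) (g : {additive M -> N}) : Prop :=
  [/\ forall m, f (dlog_alpha D m) = dlog_alpha E (g m),
      forall a, f (dlog_delta D a) = dlog_delta E (f a)
    & forall m, f (dlog_fun D m) = dlog_fun E (g m)].

Section BaseChange.
Variables (p : nat) (A A' : zlocAlg p) (M : nmodType) (D : dlog_ring A M).
Variables (d' : delta_structure A') (f : {rmorphism A -> A'}).
Hypothesis fd : forall a, f (dlog_delta D a) = d' (f a).

Let log m := f (dlog_fun D m).

Lemma base_change0 : log 0 = 0.
Proof. by rewrite /log dlog0 rmorph0. Qed.

Lemma base_change_alphaE m :
  prelog_comp f (dlog_alpha D) m ^+ p * log m =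
  d' (prelog_comp f (dlog_alpha D) m).
Proof. by rewrite /= -fd -dlog_alphaE rmorphM rmorphXn. Qed.

Lemma base_changeD m n : log (m + n) = log m + log n + p%:R * log m * log n.
Proof. by rewrite /log dlogD !rmorphD !rmorphM rmorph_nat. Qed.

Definition base_change : dlog_ring A' M :=
  DlogRing base_change0 base_change_alphaE base_changeD.

End BaseChange.

Definition is_log_extension (p : nat) (A : zlocAlg p) (M : nmodType)
    (D : dlog_ring A M) (dl : gp M -> A) : Prop :=
  (forall m, dl (to_gp m) = dlog_fun D m) /\
  (forall x y, dl (x + y) = dl x + dl y + p%:R * dl x * dl y).

Section PrelogPullback.
Variables (M N : nmodType) (A : pzSemiRingType).
Variables (alpha : prelog N A) (g : {additive M -> N}).

Lemma prelog_pullback0 : (alpha \o g) 0 = 1.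
Proof. by rewrite /= raddf0 prelog0. Qed.

Lemma prelog_pullbackD : {morph alpha \o g : m n / m + n >-> m * n}.
Proof. by move=> m n; rewrite /= raddfD prelogD. Qed.

Definition prelog_pullback : prelog M A :=
  Prelog prelog_pullback0 prelog_pullbackD.

End PrelogPullback.

Definition ma_map (R : comNzRingType) (M N : nmodType) (g : {additive M -> N}) :
    {rmorphism monoid_algebra R M -> monoid_algebra R N} :=
  ma_lift (@ma_const R N) (prelog_pullback (ma_basis R N) g).

Section MonoidExtension.
Variables (p : nat) (A : zlocAlg p) (M : nmodType) (D : dlog_ring A M).
Variables (N : addrClosed (gp M)) (sMN : forall m : M, to_gp m \in N).

Let str : {rmorphism monoid_algebra (zloc p) M -> A} :=
  ma_lift (zloc_alg_map A) (dlog_alpha D).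
Let incl : {rmorphism monoid_algebra (zloc p) M ->
                      monoid_algebra (zloc p) (submonoid N)} :=
  ma_map (zloc p) (to_sub sMN).

(* A (x)_{Z_(p)[M]} Z_(p)[N] *)
Definition ext_ring : zlocAlg p := tensor_alg str incl.

Definition ext_map : {rmorphism A -> ext_ring} := tensor_inl str incl.

Definition ext_alpha : prelog (submonoid N) ext_ring :=
  prelog_comp (tensor_inr str incl) (ma_basis (zloc p) (submonoid N)).

(* S is a delta_log-ring structure over (A, M) on [ext_ring] with its canonical
   prelog structure, and its delta_log is the restriction of dl to N. *)
Definition is_ext_dlog (dl : gp M -> A) (S : dlog_ring ext_ring (submonoid N)) :
    Prop :=
  [/\ forall n, dlog_alpha S n = ext_alpha n,
      forall n, dlog_fun S n = ext_map (dl (val n))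
    & is_dlog_hom D S ext_map (to_sub sMN)].

End MonoidExtension.

(* Main.v *)
From HB Require Import structures.
Require Import Defs.
From mathcomp Require Import all_boot all_algebra.
From mathcomp Require Import ring boolp.
From mathcomp Require classical_sets.
From mathcomp.multinomials Require Import monalg.

Set Implicit Arguments.
Unset Strict Implicit.
Unset Printing Implicit Defensive.

Import GRing.Theory.
Local Open Scope ring_scope.

(** The law x * y = x + y + p x y is a commutative monoid law on A with unit 0,
    and 1 + p (x * y) = (1 + p x) (1 + p y); the last axiom of a
    delta_log-structure says that delta_log is a monoid map from M to this
    monoid.  When p lies in the Jacobson radical every 1 + p x is a unit, so the
    monoid is a group and delta_log extends uniquely to the group completion
    ([log_extension_exists], [log_extension_unique]).

    A delta-structure on a ring B is the same thing as a ring section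
    b |-> (b, delta b) of the projection W_2(B) -> B, where W_2 denotes the
    p-typical Witt vectors of length 2 ([delta_section], [section_delta]).  Hence
    delta-structures on a tensor product are built from its universal property.
    For the extension ring T = A (x)_{Z_(p)[M]} Z_(p)[N] one takes
    A -> W_2(A) -> W_2(T) on the first factor and
    n |-> (n, n^p delta_log(n)) on N; the two agree on M precisely because
    alpha(m)^p delta_log(m) = delta(alpha(m)), and the second is multiplicative
    because delta_log is a map to the monoid above ([witt2_log_mul]).  This is
    [ext_dlog_exists].

    A ring map out of T is determined by its restrictions to A and to N
    ([ext_ring_ext]).  Compatibility with delta is the equality of two ring maps
    T -> W_2(C), so it too can be tested on A and on N, where it is forced by the
    delta_log-axioms: this gives the uniqueness of delta and the universal
    property.  For a delta_log-ring (B, N) under (A, M), the value of delta_log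
    at a fraction n = m - m' is determined by its values at m and m', since
    1 + p delta_log(m') is the image of a unit of A ([dlog_hom_ext_log]).

    For base change, A' (x)_A T carries a delta-structure by the same Witt vector
    argument ([tensor_delta_exists]).  The universal property of T gives a map
    from A' (x)_A T to the extension ring of (A', M), that of the extension ring
    gives a map back, and the two are mutually inverse because they are so on A'
    and on N ([base_change_iso]). *)

(** * The Jacobson radical *)

(** Otherwise 1 + c x generates a proper ideal, which by Zorn's lemma lies in a
    maximal one; that ideal also contains c, hence 1. *)
Lemma jacobson_unit (A : comPzRingType) (c : A) :
  jacobson_radical c -> forall x, exists y, (1 + c * x) * y = 1.
Proof.
move=> c_rad x; set u := 1 + c * x; apply: contrapT => u_nounit.
pose proper (I : ideal A) := ~ I 1 /\ I u.
pose proper_over := {I : ideal A | proper I}.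
have uA0 : exists y, 0 = u * y by exists 0; rewrite mulr0.
have uAD a b : (exists y, a = u * y) -> (exists y, b = u * y) ->
    exists y, a + b = u * y.
  by move=> [y ->] [z ->]; exists (y + z); rewrite mulrDr.
have uAM a b : (exists y, b = u * y) -> exists y, a * b = u * y.
  by move=> [y ->]; exists (a * y); rewrite mulrCA.
pose uA := Ideal uA0 uAD uAM.
have uA_proper : proper uA.
  by split=> [[y e]|]; [apply: u_nounit; exists y | exists 1; rewrite mulr1].
pose incl (I J : proper_over) : bool := `[< forall a, sval I a -> sval J a >].
have [I|I J K /asboolP IJ /asboolP JK|C C_tot|] :=
    @classical_sets.ZL_preorder proper_over (exist proper uA uA_proper) incl.
- exact/asboolP.
- by apply/asboolP => a /IJ /JK.
- have [[I0 CI0]|C0] := pselect (exists I, C I); last first.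
    exists (exist proper uA uA_proper) => I CI.
    by case: C0; exists I.
  pose bigU a := exists2 I, C I & sval I a.
  have U0 : bigU 0 by exists I0 => //; apply: ideal0.
  have UD a b : bigU a -> bigU b -> bigU (a + b).
    move=> [I CI Ia] [J CJ Jb]; case: (C_tot I J CI CJ) => /asboolP IJ.
      by exists J => //; apply: idealD => //; apply: IJ.
    by exists I => //; apply: idealD => //; apply: IJ.
  have UM a b : bigU b -> bigU (a * b).
    by move=> [I CI Ib]; exists I => //; apply: idealM.
  have U_proper : proper (Ideal U0 UD UM).
    split=> [[I CI]|]; first by case: (svalP I).
    by exists I0 => //; case: (svalP I0).
  by exists (exist proper _ U_proper) => I CI; apply/asboolP => a Ia; exists I.
move=> [J J_proper] J_max; have [J1 Ju] := J_proper.
have /c_rad Jc : maximal_ideal J.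
  split=> // K K1 JK a Ka.
  have K_proper : proper K by split=> //; apply: JK.
  have /asboolP := J_max (exist proper K K_proper) (asboolT JK).
  exact.
apply: J1; have -> : 1 = u + (- x) * c by rewrite /u; ring.
by apply: idealD => //; apply: idealM.
Qed.

(** * Monoid maps out of a group completion *)

Section GroupCompletionMaps.
Variable M : nmodType.

Lemma gp_frac (x : gp M) : exists m m', to_gp m' + x = to_gp m.
Proof.
elim/quotW: x => -[a b]; exists a, b.
rewrite -[LHS]/(gp_add _ _) gp_addE; apply/gp_eq; exists 0 => /=.
by rewrite add0r !addr0 addrC.
Qed.

(** Only the values of g have to be invertible: the target is the monoid of
    [log_monoid] below, which is not a group for every ring. *)
Lemma gp_lift_exists (W : nmodType) (g : {additive M -> W}) :
  (forall m, exists w, g m + w = 0) ->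
  exists2 G : gp M -> W, {morph G : x y / x + y} & forall m, G (to_gp m) = g m.
Proof.
move=> /choice[inv gV].
pose G (x : gp M) := g (repr x).1 + inv (repr x).2.
(* The values of g are invertible, hence cancellable. *)
have addI m : injective (+%R (g m)).
  move=> u v /(congr1 (+%R (inv m))).
  by rewrite !addrA ![inv m + _]addrC gV !add0r.
(* This characterizes the value of G at x by any presentation of x as a fraction,
   and so frees G from the representative in its definition. *)
have GE m x m' : to_gp m' + x = to_gp m -> g m' + G x = g m.
  rewrite /G -{1}[x]reprK; case: (repr x) => a b /=.
  rewrite -[to_gp m' + _]/(gp_add _ _) gp_addE => /gp_eq[k] /=.
  rewrite addr0 add0r => e; apply: (@addI (k + b)).
  have {}e := congr1 g e.
  have -> : g (k + b) + (g m' + (g a + inv b)) = g (m' + a + k) + (g b + inv b).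
    by rewrite !raddfD /= (AC (2*(1*2)) ((3*4*1)*(2*5))).
  by rewrite e gV addr0 -raddfD (AC 3 (3*2*1)).
exists G => [x y|m]; last first.
  by have := GE m (to_gp m) 0; rewrite !raddf0 !add0r; apply.
have [a [a' ea]] := gp_frac x; have [b [b' eb]] := gp_frac y.
have exy : to_gp (a' + b') + (x + y) = to_gp (a + b).
  by rewrite !raddfD /= -ea -eb addrACA.
apply: (@addI (a' + b')).
by rewrite (GE _ _ _ exy) !raddfD /= -(GE _ _ _ ea) -(GE _ _ _ eb) addrACA.
Qed.

(** Cancellability is asked of the image of M alone, so that the target can be
    the monoid of [log_monoid] below, whatever the ring. *)
Lemma fraction_ext (T W : nmodType) (i : M -> T) (g h : T -> W) :
  (forall t, exists m m', i m' + t = i m) ->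
  {morph g : x y / x + y} -> {morph h : x y / x + y} ->
  (forall m, injective (+%R (g (i m)))) ->
  (forall m, g (i m) = h (i m)) -> g =1 h.
Proof.
move=> frac gD hD can gh t; have [m [m' e]] := frac t.
by apply: (can m'); rewrite -gD e gh -e hD gh.
Qed.

Variables (N : addrClosed (gp M)) (sMN : forall m : M, to_gp m \in N).

Lemma submonoid_frac (n : submonoid N) :
  exists m m', to_sub sMN m' + n = to_sub sMN m.
Proof.
have [m [m' e]] := gp_frac (val n).
by exists m, m'; apply: val_inj; rewrite raddfD.
Qed.

Lemma to_sub_addI m : injective (+%R (to_sub sMN m)).
Proof. by move=> x y /(congr1 val); rewrite !raddfD => /addrI /val_inj. Qed.

End GroupCompletionMaps.

(** * Extending delta_log to the group completion *)

(** A with the law transported from multiplication along x |-> 1 + p x.  When p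
    is a zero divisor it retains more than the multiplicative monoid of A. *)
Definition log_monoid (p : nat) (A : comPzRingType) : Type := A.

Section LogMonoid.
Variables (p : nat) (A : comPzRingType).
Local Notation L := (log_monoid p A).

Definition log_mul (x y : A) : A := x + y + p%:R * x * y.

Lemma log_mulA : associative log_mul.
Proof. by move=> x y z; rewrite /log_mul; ring. Qed.

Lemma log_mulC : commutative log_mul.
Proof. by move=> x y; rewrite /log_mul; ring. Qed.

Lemma log_mul0 : left_id 0 log_mul.
Proof. by move=> x; rewrite /log_mul; ring. Qed.

HB.instance Definition _ := Choice.on L.
HB.instance Definition _ := GRing.isNmodule.Build L log_mulA log_mulC log_mul0.

Lemma log_mul_inv (x y : A) :
  (1 + p%:R * x) * y = 1 -> log_mul x (- (x * y)) = 0.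
Proof.
move=> e; have -> : log_mul x (- (x * y)) = x * (1 - (1 + p%:R * x) * y).
  by rewrite /log_mul; ring.
by rewrite e subrr mulr0.
Qed.

Lemma log_mulI (x y : A) : (1 + p%:R * x) * y = 1 -> injective (log_mul x).
Proof.
move=> e u v uv.
have E w : log_mul x w = x + (1 + p%:R * x) * w by rewrite /log_mul; ring.
move: uv; rewrite !E => /addrI /(congr1 ( *%R y)).
by rewrite !mulrA ![y * _]mulrC e !mul1r.
Qed.

End LogMonoid.

Section LogExtension.
Variables (p : nat) (A : zlocAlg p) (M : nmodType) (D : dlog_ring A M).
Hypothesis p_rad : jacobson_radical (p%:R : A).

Lemma dlog_is_nmod_morphism :
  nmod_morphism (dlog_fun D : M -> log_monoid p A).
Proof. by split; [exact: dlog0 | exact: dlogD]. Qed.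

HB.instance Definition _ := GRing.isNmodMorphism.Build M (log_monoid p A)
  (dlog_fun D : M -> log_monoid p A) dlog_is_nmod_morphism.

Lemma log_extension_exists : exists dl, is_log_extension D dl.
Proof.
have [|dl dlD dlE] :=
    @gp_lift_exists M (log_monoid p A) (dlog_fun D : M -> log_monoid p A).
  move=> m; have [y e] := jacobson_unit p_rad (dlog_fun D m).
  by exists (- (dlog_fun D m * y)); apply: log_mul_inv e.
by exists dl; split.
Qed.

Lemma log_extension_unique dl dl' :
  is_log_extension D dl -> is_log_extension D dl' -> dl' =1 dl.
Proof.
move=> [dlE dlD] [dlE' dlD'].
apply: (@fraction_ext M _ (log_monoid p A) (@to_gp M)) => //.
- exact: gp_frac.
- move=> m; have [y e] := jacobson_unit p_rad (dl' (to_gp m)).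
  exact: log_mulI e.
- by move=> m; rewrite dlE dlE'.
Qed.

End LogExtension.

(** * Witt vectors of length 2 *)

Section WittPolynomial.
Variable p : nat.

(** ((x + y)^p - x^p - y^p) / p, in the form used by [deltaD]. *)
Definition wittP (A : comPzRingType) (x y : A) : A :=
  \sum_(1 <= i < p)
    ((p.-1)`! %/ (i`! * (p - i)`!))%:R * x ^+ i * y ^+ (p - i).

Lemma rmorph_wittP (A B : comPzRingType) (f : {rmorphism A -> B}) x y :
  f (wittP x y) = wittP (f x) (f y).
Proof.
rewrite rmorph_sum; apply: eq_bigr => i _.
by rewrite !rmorphM !rmorphXn rmorph_nat.
Qed.

Hypothesis p_prime : prime p.

Lemma wittP_coef i : (0 < i < p)%N ->
  (p * ((p.-1)`! %/ (i`! * (p - i)`!)))%N = 'C(p, i).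
Proof.
move=> /andP[i0 ip].
have /dvdnP[q e] : (p %| 'C(p, i))%N by apply: prime_dvd_bin; rewrite ?i0.
have := bin_fact (ltnW ip); rewrite e -{3}(prednK (prime_gt0 p_prime)) factS.
rewrite (prednK (prime_gt0 p_prime)) -mulnA mulnCA => /eqP.
rewrite eqn_pmul2l ?prime_gt0 // => /eqP <-.
by rewrite mulnK 1?mulnC // muln_gt0 !fact_gt0.
Qed.

Lemma wittPE (A : comPzRingType) (x y : A) :
  (x + y) ^+ p = x ^+ p + y ^+ p + p%:R * wittP x y.
Proof.
have p_gt0 := prime_gt0 p_prime.
rewrite addrC exprDn.
rewrite -(big_mkord xpredT (fun i => y ^+ (p - i) * x ^+ i *+ 'C(p, i))).
rewrite big_nat_recr //= big_ltn //= subn0 subnn bin0 binn !expr0 mulr1 mul1r.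
rewrite !mulr1n addrAC (addrC (y ^+ p)); congr (_ + _).
rewrite mulr_sumr; apply: eq_big_nat => i /wittP_coef <-.
by rewrite -mulr_natl natrM; ring.
Qed.

Lemma wittPC (A : comPzRingType) (x y : A) : wittP x y = wittP y x.
Proof.
rewrite /wittP big_nat_rev /=; apply: eq_big_nat => i /andP[i0 ip].
rewrite add1n subSS subKn; last exact: ltnW.
by rewrite mulnC mulrAC.
Qed.

Lemma wittPMr (A : comPzRingType) (x y z : A) :
  wittP (x * z) (y * z) = wittP x y * z ^+ p.
Proof.
rewrite /wittP mulr_suml; apply: eq_big_nat => i /andP[_ ip].
by rewrite !exprMn -[in z ^+ p](subnKC (ltnW ip)) exprD; ring.
Qed.

Lemma wittP0 (A : comPzRingType) (x : A) : wittP 0 x = 0.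
Proof.
rewrite /wittP big_nat; apply: big1 => i /andP[i0 _].
by rewrite expr0n gtn_eqF // mulr0 mul0r.
Qed.

End WittPolynomial.

Lemma monoid_algebra_int_torsionfree (M : nmodType) n
  (g h : monoid_algebra int M) : (0 < n)%N -> n%:R * g = n%:R * h -> g = h.
Proof.
move=> n_gt0; rewrite !mulr_natl => e; apply/malgP => k.
have /eqP := congr1 (mcoeff k) e; rewrite !mcoeffMn.
by rewrite Num.Theory.eqr_pMn2r // => /eqP.
Qed.

(** The tautological prelog structure, whose lift is the map Z[A] -> A. *)
Definition mul_id (A : comPzRingType) : prelog (mul_monoid A) A :=
  @Prelog (mul_monoid A) A id erefl (fun x y => erefl).

(** Identities between integral polynomials need only be checked after
    multiplication by an integer: every ring A is a quotient of the monoid ring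
    of its multiplicative monoid, which is torsion free. *)
Lemma torsionfree_cover (A : comPzRingType) :
  exists (F : comPzRingType) (ev : {rmorphism F -> A}),
    (forall a, exists b, ev b = a) /\
    (forall n (g h : F), (0 < n)%N -> n%:R * g = n%:R * h -> g = h).
Proof.
exists (monoid_algebra int (mul_monoid A)).
exists (ma_lift (intr : {rmorphism int -> A}) (mul_id A)); split=> [a|n g h].
  by exists (monomial 1 (a : mul_monoid A)); rewrite /= ma_liftU rmorph1 mul1r.
exact: monoid_algebra_int_torsionfree.
Qed.

(** Both sides, multiplied by p, are (x + y + z)^p - x^p - y^p - z^p. *)
Lemma wittP_cocycle p (p_prime : prime p) (A : comPzRingType) (x y z : A) :
  wittP p y z + wittP p x (y + z) = wittP p x y + wittP p (x + y) z.
Proof.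
have [F [ev [ev_surj F_tf]]] := torsionfree_cover A.
have [x' <-] := ev_surj x; have [y' <-] := ev_surj y.
have [z' <-] := ev_surj z; rewrite -!rmorphD -!rmorph_wittP -!rmorphD.
congr (ev _); apply: (F_tf p); rewrite ?prime_gt0 // !mulrDr.
have E (a b : F) : p%:R * wittP p a b = (a + b) ^+ p - a ^+ p - b ^+ p.
  by rewrite (wittPE p_prime); ring.
by rewrite !E (addrA x'); ring.
Qed.

(** The primality proof is a parameter because the ring axioms depend on it. *)
Definition witt2 (p : nat) (p_prime : prime p) (B : comPzRingType) : Type :=
  (B * B)%type.

Section WittRing.
Variables (p : nat) (p_prime : prime p) (B : comPzRingType).
Local Notation W := (witt2 p_prime B).
Local Notation P := (wittP p).

Definition witt2_zero : W := (0, 0).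
Definition witt2_one : W := (1, 0).
Definition witt2_opp (x : W) : W := (- x.1, - x.2 + P (- x.1) x.1).
Definition witt2_add (x y : W) : W := (x.1 + y.1, x.2 + y.2 - P x.1 y.1).
Definition witt2_mul (x y : W) : W :=
  (x.1 * y.1, x.2 * y.1 ^+ p + x.1 ^+ p * y.2 + p%:R * x.2 * y.2).

Lemma witt2_addA : associative witt2_add.
Proof.
move=> [x x'] [y y'] [z z']; congr pair; rewrite /= ?addrA //.
have E : P y z = P x y + P (x + y) z - P x (y + z).
  by rewrite -(wittP_cocycle p_prime); ring.
by rewrite E; ring.
Qed.

Lemma witt2_addC : commutative witt2_add.
Proof.
by move=> [x x'] [y y']; rewrite /witt2_add /= (addrC x) (addrC x') wittPC.
Qed.

Lemma witt2_add0 : left_id witt2_zero witt2_add.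
Proof. by move=> [x x']; congr pair; rewrite /= ?wittP0 add0r ?subr0. Qed.

Lemma witt2_addN : left_inverse witt2_zero witt2_opp witt2_add.
Proof. by move=> [x x']; congr pair; rewrite /=; ring. Qed.

Lemma witt2_mulA : associative witt2_mul.
Proof.
by move=> [x x'] [y y'] [z z']; congr pair; rewrite /= ?exprMn; ring.
Qed.

Lemma witt2_mulC : commutative witt2_mul.
Proof. by move=> [x x'] [y y']; congr pair; rewrite /=; ring. Qed.

Lemma witt2_mul1 : left_id witt2_one witt2_mul.
Proof. by move=> [x x']; congr pair; rewrite /= ?expr1n; ring. Qed.

Lemma witt2_mulDl : left_distributive witt2_mul witt2_add.
Proof.
move=> [x x'] [y y'] [z z']; congr pair; rewrite /= ?wittPMr ?wittPE //; ring.
Qed.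

HB.instance Definition _ := Choice.on W.
HB.instance Definition _ := GRing.isZmodule.Build W
  witt2_addA witt2_addC witt2_add0 witt2_addN.
HB.instance Definition _ := GRing.Zmodule_isComPzRing.Build W
  witt2_mulA witt2_mulC witt2_mul1 witt2_mulDl.

(** (a, a^p x) is the product of the Teichmuller lift of a and (1, x), and the
    elements (1, x) multiply by the law of [log_monoid]. *)
Lemma witt2_log_mul (a b x y : B) :
  ((a, a ^+ p * x) : W) * ((b, b ^+ p * y) : W) =
  (a * b, (a * b) ^+ p * (x + y + p%:R * x * y)).
Proof. by congr pair; rewrite /= ?exprMn; ring. Qed.

End WittRing.

Section WittMap.
Variables (p : nat) (p_prime : prime p) (B C : comPzRingType).
Variable f : {rmorphism B -> C}.

Definition witt2_map (x : witt2 p_prime B) : witt2 p_prime C :=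
  (f x.1, f x.2).

Lemma witt2_map_is_nmod_morphism : nmod_morphism witt2_map.
Proof.
split=> [|x y]; first by rewrite /witt2_map /= !rmorph0.
by congr pair; rewrite /= ?rmorphB !rmorphD ?rmorph_wittP.
Qed.

Lemma witt2_map_is_monoid_morphism : monoid_morphism witt2_map.
Proof.
split=> [|x y]; first by rewrite /witt2_map /= rmorph0 rmorph1.
by congr pair; rewrite /= ?rmorphD !rmorphM // !rmorphXn rmorph_nat.
Qed.

HB.instance Definition _ := GRing.isNmodMorphism.Build
  (witt2 p_prime B) (witt2 p_prime C) witt2_map witt2_map_is_nmod_morphism.
HB.instance Definition _ := GRing.isMonoidMorphism.Build
  (witt2 p_prime B) (witt2 p_prime C) witt2_map witt2_map_is_monoid_morphism.

End WittMap.

Section WittProjection.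
Variables (p : nat) (p_prime : prime p) (B : comPzRingType).

Definition witt2_proj (x : witt2 p_prime B) : B := x.1.

Lemma witt2_proj_is_nmod_morphism : nmod_morphism witt2_proj.
Proof. by []. Qed.

Lemma witt2_proj_is_monoid_morphism : monoid_morphism witt2_proj.
Proof. by []. Qed.

HB.instance Definition _ := GRing.isNmodMorphism.Build
  (witt2 p_prime B) B witt2_proj witt2_proj_is_nmod_morphism.
HB.instance Definition _ := GRing.isMonoidMorphism.Build
  (witt2 p_prime B) B witt2_proj witt2_proj_is_monoid_morphism.

End WittProjection.

(** * Delta-structures as sections of Witt vectors *)

Section DeltaSection.
Variables (p : nat) (p_prime : prime p) (B : zlocAlg p).

Definition delta_section (d : delta_structure B) (b : B) : witt2 p_prime B :=
  (b, d b).

Section IsMorphism.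
Variable d : delta_structure B.

Lemma delta_section_is_nmod_morphism : nmod_morphism (delta_section d).
Proof.
split=> [|x y]; first by rewrite /delta_section delta0.
by rewrite /delta_section deltaD.
Qed.

Lemma delta_section_is_monoid_morphism : monoid_morphism (delta_section d).
Proof.
split=> [|x y]; first by rewrite /delta_section delta1.
by rewrite /delta_section deltaM.
Qed.

HB.instance Definition _ := GRing.isNmodMorphism.Build
  B (witt2 p_prime B) (delta_section d) delta_section_is_nmod_morphism.
HB.instance Definition _ := GRing.isMonoidMorphism.Build
  B (witt2 p_prime B) (delta_section d) delta_section_is_monoid_morphism.

End IsMorphism.

Lemma section_delta (s : {rmorphism B -> witt2 p_prime B}) :
  (forall b, (s b).1 = b) -> exists d : delta_structure B, forall b, d b = (s b).2.
Proof.
move=> s1; pose d b := (s b).2.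
have d0 : d 0 = 0 by rewrite /d rmorph0.
have d1 : d 1 = 0 by rewrite /d rmorph1.
have dM x y : d (x * y) = d x * y ^+ p + x ^+ p * d y + p%:R * d x * d y.
  by rewrite /d rmorphM /= !s1.
have dD x y : d (x + y) = d x + d y - wittP p x y.
  by rewrite /d rmorphD /= !s1.
by exists (DeltaStructure d0 d1 dM dD).
Qed.

End DeltaSection.

(** * Ring maps out of quotients, monoid rings and tensor products *)

Section QuotientLift.
Variables (A C : comPzRingType) (I : ideal A) (f : {rmorphism A -> C}).
Definition quotient_lift (f_kills : forall x, I x -> f x = 0)
  (x : quotient_ring I) : C := f (repr x).

Hypothesis f_kills : forall x, I x -> f x = 0.
Local Notation lift := (quotient_lift f_kills).

Lemma quotient_liftE x : lift (to_quotient I x) = f x.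
Proof. by apply/subr0_eq; rewrite -rmorphB; apply/f_kills/repr_quotient. Qed.

Lemma quotient_lift_is_nmod_morphism : nmod_morphism lift.
Proof.
split; first by rewrite -(rmorph0 (to_quotient I)) quotient_liftE rmorph0.
elim/quotient_ind=> x; elim/quotient_ind=> y.
by rewrite -rmorphD !quotient_liftE rmorphD.
Qed.

Lemma quotient_lift_is_monoid_morphism : monoid_morphism lift.
Proof.
split; first by rewrite -(rmorph1 (to_quotient I)) quotient_liftE rmorph1.
elim/quotient_ind=> x; elim/quotient_ind=> y.
by rewrite -rmorphM !quotient_liftE rmorphM.
Qed.

HB.instance Definition _ := GRing.isNmodMorphism.Build
  (quotient_ring I) C lift quotient_lift_is_nmod_morphism.
HB.instance Definition _ := GRing.isMonoidMorphism.Build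
  (quotient_ring I) C lift quotient_lift_is_monoid_morphism.

End QuotientLift.

Lemma monoid_algebra_ext (R : comNzRingType) (M : nmodType)
    (C : comPzRingType) (u v : {rmorphism monoid_algebra R M -> C}) :
  (forall c, u (ma_const M c) = v (ma_const M c)) ->
  (forall m, u (monomial 1 m) = v (monomial 1 m)) -> u =1 v.
Proof.
move=> uv_const uv_basis g; elim/malg_ind: g => [|g h IHg IHh|c m].
- by rewrite (rmorph0 u) (rmorph0 v).
- by rewrite (rmorphD u) (rmorphD v) IHg IHh.
have -> : << c *g m >> = ma_const M c * monomial 1 m :> monoid_algebra R M.
  by rewrite -[RHS]/(ma_mul _ _) ma_mulUU mulr1 add0r.
by rewrite (rmorphM u) (rmorphM v) uv_const uv_basis.
Qed.

Section MonoidAlgebraLiftValues.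
Variables (R : comNzRingType) (M : nmodType) (C : comPzRingType).
Variables (f : {rmorphism R -> C}) (alpha : prelog M C).

Lemma ma_lift_basis m : ma_lift f alpha (monomial 1 m) = alpha m.
Proof. by rewrite ma_liftU rmorph1 mul1r. Qed.

Lemma ma_lift_const c : ma_lift f alpha (ma_const M c) = f c.
Proof. by rewrite ma_liftU prelog0 mulr1. Qed.

End MonoidAlgebraLiftValues.

Section TensorMaps.
Variables (R A B C : comPzRingType).
Variables (f : {rmorphism R -> A}) (g : {rmorphism R -> B}).
Local Notation T := (tensor f g).
Local Notation inl := (tensor_inl f g).
Local Notation inr := (tensor_inr f g).

(** The values of f and g are named so that they can be given in simplified form. *)
Lemma tensor_balanced r a b : f r = a -> g r = b -> inl a = inr b.
Proof. by move=> <- <-; have := tpureZ f g r 1 1; rewrite !mulr1. Qed.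

Lemma tensor_ext (u v : {rmorphism T -> C}) :
  (forall a, u (inl a) = v (inl a)) -> (forall b, u (inr b) = v (inr b)) ->
  u =1 v.
Proof.
move=> uv_inl uv_inr; elim/quotient_ind=> x.
pose pi : {rmorphism _ -> T} := to_quotient (ideal_generated (tensor_rel f g)).
apply: (@monoid_algebra_ext _ _ C (u \o pi) (v \o pi)) => [c|[a b]] /=.
  by rewrite -(intz c) !rmorph_int.
have -> : pi (monomial 1 (a, b)) = inl a * inr b.
  by rewrite tpureM mulr1 mul1r.
by rewrite !rmorphM uv_inl uv_inr.
Qed.

Variables (u : {rmorphism A -> C}) (v : {rmorphism B -> C}).
Hypothesis uv : forall r, u (f r) = v (g r).

Let sym_lift (x : mul_monoid A * mul_monoid B) : C := u x.1 * v x.2.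

Let sym_lift0 : sym_lift 0 = 1.
Proof. by rewrite /sym_lift !rmorph1 mulr1. Qed.

Let sym_liftD : {morph sym_lift : x y / x + y >-> x * y}.
Proof. by move=> x y; rewrite /sym_lift !rmorphM mulrACA. Qed.

Lemma tensor_lift_exists :
  exists2 w : {rmorphism T -> C},
    forall a, w (inl a) = u a & forall b, w (inr b) = v b.
Proof.
pose F : {rmorphism _ -> C} :=
  ma_lift (intr : {rmorphism int -> C}) (Prelog sym_lift0 sym_liftD).
have FE a b : F (tensor_sym a b) = u a * v b.
  by rewrite /F /= ma_liftU rmorph1 mul1r.
have ker0 : F 0 = 0 by rewrite rmorph0.
have kerD x y : F x = 0 -> F y = 0 -> F (x + y) = 0.
  by move=> x0 y0; rewrite rmorphD x0 y0 addr0.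
have kerM x y : F y = 0 -> F (x * y) = 0.
  by move=> y0; rewrite rmorphM y0 mulr0.
have F_kills x : ideal_generated (tensor_rel f g) x -> F x = 0.
  move=> xT; apply: (xT (Ideal ker0 kerD kerM)) => y [a a' b|a b b'|r a b] /=.
  - by rewrite rmorphB rmorphD !FE rmorphD mulrDl subrr.
  - by rewrite rmorphB rmorphD !FE rmorphD mulrDr subrr.
  - by rewrite rmorphB !FE !rmorphM uv -mulrA mulrCA subrr.
exists (quotient_lift F_kills) => [a|b].
  apply: etrans (quotient_liftE F_kills (tensor_sym a 1)) _.
  by rewrite FE rmorph1 mulr1.
apply: etrans (quotient_liftE F_kills (tensor_sym 1 b)) _.
by rewrite FE rmorph1 mul1r.
Qed.

End TensorMaps.

(** * The universal property of the extension ring *)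

Section ExtensionRing.
Variables (p : nat) (A : zlocAlg p) (M : nmodType) (D : dlog_ring A M).
Variables (N : addrClosed (gp M)) (sMN : forall m : M, to_gp m \in N).
Local Notation ext := (ext_ring D sMN).
Local Notation ext_map := (ext_map D sMN).
Local Notation ext_alpha := (ext_alpha D sMN).
Local Notation ZM := (monoid_algebra (zloc p) M).
Local Notation ZN := (monoid_algebra (zloc p) (submonoid N)).

Let str : {rmorphism ZM -> A} := ma_lift (zloc_alg_map A) (dlog_alpha D).
Let incl : {rmorphism ZM -> ZN} := ma_map (zloc p) (to_sub sMN).

Let strE m : str (monomial 1 m) = dlog_alpha D m.
Proof. exact: ma_lift_basis. Qed.

Let str_const c : str (ma_const M c) = zloc_alg_map A c.
Proof. exact: ma_lift_const. Qed.

Let inclE m : incl (monomial 1 m) = monomial 1 (to_sub sMN m).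
Proof. exact: ma_lift_basis. Qed.

Let incl_const c : incl (ma_const M c) = ma_const (submonoid N) c.
Proof. exact: ma_lift_const. Qed.

Lemma ext_map_alpha m : ext_map (dlog_alpha D m) = ext_alpha (to_sub sMN m).
Proof. exact: tensor_balanced (strE m) (inclE m). Qed.

(** The constants of Z_(p)[N] come from Z_(p)[M], so they already lie in the
    image of A. *)
Lemma ext_ring_ext (C : comPzRingType) (u v : {rmorphism ext -> C}) :
  (forall a, u (ext_map a) = v (ext_map a)) ->
  (forall n, u (ext_alpha n) = v (ext_alpha n)) -> u =1 v.
Proof.
move=> uv_map uv_alpha; apply: tensor_ext => // b.
pose inr : {rmorphism ZN -> ext} := tensor_inr str incl.
apply: (@monoid_algebra_ext _ _ C (u \o inr) (v \o inr)) => [c|n].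
  have e : ext_map (zloc_alg_map A c) = inr (ma_const _ c).
    exact: tensor_balanced (str_const c) (incl_const c).
  by rewrite [LHS](congr1 u (esym e)) [RHS](congr1 v (esym e)).
exact: uv_alpha.
Qed.

Lemma ext_ring_lift_exists (C : comPzRingType) (f : {rmorphism A -> C})
    (beta : prelog (submonoid N) C) :
  (forall m, f (dlog_alpha D m) = beta (to_sub sMN m)) ->
  exists2 w : {rmorphism ext -> C},
    forall a, w (ext_map a) = f a & forall n, w (ext_alpha n) = beta n.
Proof.
move=> f_beta.
pose fz : {rmorphism zloc p -> C} := f \o zloc_alg_map A.
pose v : {rmorphism ZN -> C} := ma_lift fz beta.
have fv : forall x, f (str x) = v (incl x).
  apply: (@monoid_algebra_ext _ _ C (f \o str) (v \o incl)) => [c|m].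
    rewrite [LHS](congr1 f (str_const c)) [RHS](congr1 v (incl_const c)).
    by rewrite [RHS]ma_lift_const.
  rewrite [LHS](congr1 f (strE m)) [RHS](congr1 v (inclE m)).
  by rewrite [RHS]ma_lift_basis.
have [w w_inl w_inr] := tensor_lift_exists fv.
exists w => // n; apply: etrans (w_inr (monomial 1 n)) _.
exact: ma_lift_basis.
Qed.

End ExtensionRing.

(** * Delta-structures on tensor products *)

Section TensorDelta.
Variables (p : nat) (p_prime : prime p) (R : comPzRingType) (A B : zlocAlg p).
Variables (f : {rmorphism R -> A}) (g : {rmorphism R -> B}).
Local Notation T := (tensor_alg f g).
Local Notation inl := (tensor_inl f g : {rmorphism A -> T}).
Local Notation inr := (tensor_inr f g : {rmorphism B -> T}).

Lemma tensor_delta_unique (d d' : delta_structure T) :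
  (forall a, d (inl a) = d' (inl a)) -> (forall b, d (inr b) = d' (inr b)) ->
  d =1 d'.
Proof.
move=> d_inl d_inr x.
pose u : {rmorphism T -> witt2 p_prime T} := delta_section p_prime d.
pose v : {rmorphism T -> witt2 p_prime T} := delta_section p_prime d'.
suff /(congr1 snd) : u x = v x by [].
move: x; apply: (tensor_ext (u := u) (v := v)) => [a|b].
  by congr pair; apply: d_inl.
by congr pair; apply: d_inr.
Qed.

(** The sections A -> W_2(A) -> W_2(T) and B -> W_2(B) -> W_2(T) agree on R,
    as f and g commute with the same operation dR on R. *)
Lemma tensor_delta_exists (dR : R -> R) (dA : delta_structure A)
    (dB : delta_structure B) :
  (forall r, f (dR r) = dA (f r)) -> (forall r, g (dR r) = dB (g r)) ->
  exists d : delta_structure T,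
    (forall a, inl (dA a) = d (inl a)) /\ (forall b, inr (dB b) = d (inr b)).
Proof.
move=> f_delta g_delta.
pose u : {rmorphism A -> witt2 p_prime T} :=
  witt2_map inl \o delta_section p_prime dA.
pose v : {rmorphism B -> witt2 p_prime T} :=
  witt2_map inr \o delta_section p_prime dB.
have uv r : u (f r) = v (g r).
  congr pair; first exact: (@tensor_balanced _ _ _ f g r).
  exact: (tensor_balanced (f_delta r) (g_delta r)).
have [s s_inl s_inr] := tensor_lift_exists uv.
have s1 x : (s x).1 = x.
  apply: (@tensor_ext _ _ _ _ _ _ (@witt2_proj p p_prime T \o s) idfun) => [a|b].
    exact: (congr1 fst (s_inl a)).
  exact: (congr1 fst (s_inr b)).
have [d dE] := section_delta (B := T) s1.
exists d; split=> [a|b]; rewrite dE.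
  exact: esym (congr1 snd (s_inl a)).
exact: esym (congr1 snd (s_inr b)).
Qed.

End TensorDelta.

(** * The delta_log-structure of the extension ring *)

Section ExtensionDelta.
Variables (p : nat) (p_prime : prime p) (A : zlocAlg p) (M : nmodType).
Variables (D : dlog_ring A M).
Variables (N : addrClosed (gp M)) (sMN : forall m : M, to_gp m \in N).
Local Notation ext := (ext_ring D sMN).
Local Notation ext_map := (ext_map D sMN).
Local Notation ext_alpha := (ext_alpha D sMN).
Variable dl : gp M -> A.

(** Compatibility with delta says that two ring maps to W_2(C) agree. *)
Lemma ext_delta_compat (C : zlocAlg p) (d : delta_structure ext)
    (dC : delta_structure C) (h : {rmorphism ext -> C}) :
  (forall a, h (d (ext_map a)) = dC (h (ext_map a))) ->
  (forall n, h (d (ext_alpha n)) = dC (h (ext_alpha n))) ->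
  forall x, h (d x) = dC (h x).
Proof.
move=> h_map h_alpha x.
pose u : {rmorphism ext -> witt2 p_prime C} :=
  witt2_map h \o delta_section p_prime d.
pose v : {rmorphism ext -> witt2 p_prime C} := delta_section p_prime dC \o h.
suff /(congr1 snd) : u x = v x by [].
move: x; apply: (ext_ring_ext (u := u) (v := v)) => [a|n].
  by congr pair; apply: h_map.
by congr pair; apply: h_alpha.
Qed.

(** The axiom relating delta and delta_log leaves no choice for delta on N. *)
Lemma ext_dlog_delta_alpha (S : dlog_ring ext (submonoid N)) n :
  is_ext_dlog dl S ->
  dlog_delta S (ext_alpha n) = ext_alpha n ^+ p * ext_map (dl (val n)).
Proof.
by move=> [S_alpha S_log _]; rewrite -S_log -S_alpha dlog_alphaE.
Qed.

Lemma ext_dlog_unique (S S' : dlog_ring ext (submonoid N)) :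
  is_ext_dlog dl S -> is_ext_dlog dl S' -> dlog_delta S' =1 dlog_delta S.
Proof.
move=> S_ext S'_ext.
have [_ _ [_ S_delta _]] := S_ext; have [_ _ [_ S'_delta _]] := S'_ext.
suff : forall x, idfun (dlog_delta S' x) = dlog_delta S (idfun x) by [].
apply: ext_delta_compat => [a|n].
  exact: etrans (esym (S'_delta a)) (S_delta a).
apply: etrans (ext_dlog_delta_alpha n S'_ext) _.
exact: esym (ext_dlog_delta_alpha n S_ext).
Qed.

Hypothesis dl_ext : is_log_extension D dl.

(* The multiplicative map n |-> (n, n^p delta_log(n)) from N to W_2. *)
Let witt_alpha (n : submonoid N) : witt2 p_prime ext :=
  (ext_alpha n, ext_alpha n ^+ p * ext_map (dl (val n))).

Let log0 : ext_map (dl (val (0 : submonoid N))) = 0.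
Proof.
have [dlE _] := dl_ext.
by rewrite raddf0 -(raddf0 (@to_gp M)) dlE dlog0 rmorph0.
Qed.

Let logD m n : ext_map (dl (val (m + n : submonoid N))) =
  ext_map (dl (val m)) + ext_map (dl (val n)) +
  p%:R * ext_map (dl (val m)) * ext_map (dl (val n)).
Proof.
have [_ dlD] := dl_ext.
by rewrite raddfD /= dlD !rmorphD !rmorphM rmorph_nat.
Qed.

Let witt_alpha0 : witt_alpha 0 = 1.
Proof. by rewrite /witt_alpha log0 mulr0 prelog0. Qed.

Let witt_alphaD : {morph witt_alpha : x y / x + y >-> x * y}.
Proof.
move=> x y; rewrite /witt_alpha logD prelogD.
exact: esym (witt2_log_mul p_prime _ _ _ _).
Qed.

Lemma ext_dlog_exists :
  exists S : dlog_ring ext (submonoid N), is_ext_dlog dl S.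
Proof.
have [dlE _] := dl_ext.
pose f : {rmorphism A -> witt2 p_prime ext} :=
  witt2_map ext_map \o delta_section p_prime (dlog_delta D).
pose beta := Prelog witt_alpha0 witt_alphaD.
have f_beta m : f (dlog_alpha D m) = beta (to_sub sMN m).
  rewrite [RHS]/(witt_alpha _) /witt_alpha -ext_map_alpha [dl _]dlE.
  by rewrite -rmorphXn -rmorphM dlog_alphaE.
have [s s_map s_alpha] := ext_ring_lift_exists f_beta.
have s1 x : (s x).1 = x.
  apply: (@ext_ring_ext _ _ _ _ _ _ _ (@witt2_proj p p_prime ext \o s) idfun).
    by move=> a; apply: (congr1 fst (s_map a)).
  by move=> n; apply: (congr1 fst (s_alpha n)).
have [d dE] := section_delta (B := ext) s1.
have log_alphaE n :
    ext_alpha n ^+ p * ext_map (dl (val n)) = d (ext_alpha n).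
  by rewrite dE; apply: esym (congr1 snd (s_alpha n)).
pose log n := ext_map (dl (val (n : submonoid N))).
pose S := @DlogRing p ext (submonoid N) d ext_alpha log log0 log_alphaE logD.
exists S; split=> [n|n|]; [exact: erefl | exact: erefl | split=> [m|a|m]].
- exact: ext_map_alpha.
- exact: etrans (esym (congr1 snd (s_map a))) (esym (dE _)).
- exact: congr1 (esym (dlE m)).
Qed.

Section Universal.
Variables (S : dlog_ring ext (submonoid N)) (S_ext : is_ext_dlog dl S).
Variables (B : zlocAlg p) (E : dlog_ring B (submonoid N)).
Variables (f : {rmorphism A -> B}) (f_hom : is_dlog_hom D E f (to_sub sMN)).
Hypothesis p_rad : jacobson_radical (p%:R : A).

(** Both sides are maps from N to the monoid [log_monoid p B] that agree on M.
    The values at M are cancellable there, since 1 + p delta_log(m) is the image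
    of a unit of A. *)
Lemma dlog_hom_ext_log n : f (dl (val n)) = dlog_fun E n.
Proof.
have [dlE dlD] := dl_ext; have [_ _ f_log] := f_hom.
move: n; apply: (@fraction_ext M _ (log_monoid p B) (to_sub sMN)).
- exact: submonoid_frac.
- by move=> x y; rewrite raddfD /= dlD !rmorphD !rmorphM rmorph_nat.
- by move=> x y; rewrite dlogD.
- move=> m; have [y e] := jacobson_unit p_rad (dl (to_gp m)).
  apply: (@log_mulI p B _ (f y)).
  by rewrite -(rmorph_nat f) -!(rmorph1 f) -!rmorphM -!rmorphD -rmorphM e.
- by move=> m; rewrite -f_log; apply: congr1 (dlE m).
Qed.

Lemma ext_dlog_lift_exists :
  exists h : {rmorphism ext -> B},
    is_dlog_hom S E h idfun /\ h \o ext_map =1 f.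
Proof.
have [S_alpha S_log [_ S_delta _]] := S_ext.
have [f_alpha f_delta _] := f_hom.
have [h h_map h_alpha] := ext_ring_lift_exists f_alpha.
exists h; split; last exact: h_map; split=> [n|x|n].
- by rewrite S_alpha h_alpha.
- move: x; apply: ext_delta_compat => [a|n].
    apply: etrans (congr1 h (esym (S_delta a))) _.
    exact: etrans (h_map _) (etrans (f_delta a) (congr1 _ (esym (h_map a)))).
  apply: etrans (congr1 h (ext_dlog_delta_alpha n S_ext)) _.
  have h_log := etrans (h_map _) (dlog_hom_ext_log n).
  apply: etrans (rmorphM h _ _) _; rewrite rmorphXn.
  apply: etrans (congr2 (fun a x => a ^+ p * x) (h_alpha n) h_log) _.
  exact: etrans (dlog_alphaE E n) (congr1 _ (esym (h_alpha n))).
- apply: etrans (congr1 h (S_log n)) _.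
  exact: etrans (h_map _) (dlog_hom_ext_log n).
Qed.

Lemma ext_dlog_lift_unique (h h' : {rmorphism ext -> B})
    (g' : {additive submonoid N -> submonoid N}) :
  is_dlog_hom S E h idfun -> h \o ext_map =1 f ->
  is_dlog_hom S E h' g' -> h' \o ext_map =1 f ->
  g' \o to_sub sMN =1 to_sub sMN ->
  h' =1 h /\ g' =1 idfun.
Proof.
move=> [h_alpha _ _] h_map [h'_alpha _ _] h'_map g'_sub.
have [S_alpha _ _] := S_ext.
have g'E : g' =1 idfun.
  apply: (@fraction_ext M _ (submonoid N) (to_sub sMN)).
  - exact: submonoid_frac.
  - exact: raddfD.
  - by move=> x y; exact: erefl.
  - by move=> m; rewrite [g' _]g'_sub; apply: to_sub_addI.
  - exact: g'_sub.
split; last exact: g'E.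
apply: ext_ring_ext => [a|n].
  exact: etrans (h'_map a) (esym (h_map a)).
apply: etrans (congr1 h' (esym (S_alpha n))) _; rewrite h'_alpha g'E -h_alpha.
exact: congr1 (S_alpha n).
Qed.

End Universal.

End ExtensionDelta.

(** * Base change *)

Section BaseChangeIso.
Variables (p : nat) (p_prime : prime p) (A : zlocAlg p) (M : nmodType).
Variables (D : dlog_ring A M) (p_rad : jacobson_radical (p%:R : A)).
Variables (N : addrClosed (gp M)) (sMN : forall m : M, to_gp m \in N).
Variables (dl : gp M -> A) (dl_ext : is_log_extension D dl).
Variables (S : dlog_ring (ext_ring D sMN) (submonoid N)).
Hypothesis S_ext : is_ext_dlog dl S.
Variables (A' : zlocAlg p) (d' : delta_structure A') (f : {rmorphism A -> A'}).
Hypothesis fd : forall a, f (dlog_delta D a) = d' (f a).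
Local Notation D' := (base_change fd).
Variables (dl' : gp M -> A') (S' : dlog_ring (ext_ring D' sMN) (submonoid N)).
Hypothesis S'_ext : is_ext_dlog dl' S'.
Local Notation U := (tensor_alg f (ext_map D sMN)).
Local Notation inl := (tensor_inl f (ext_map D sMN) : {rmorphism A' -> U}).
Local Notation inr :=
  (tensor_inr f (ext_map D sMN) : {rmorphism ext_ring D sMN -> U}).

Lemma base_change_ext_hom :
  is_dlog_hom D S' (ext_map D' sMN \o f) (to_sub sMN).
Proof.
have [_ _ [S'_alpha S'_delta S'_log]] := S'_ext.
split=> [m|a|m].
- exact: S'_alpha.
- apply: etrans (S'_delta (f a)); exact: congr1 (fd a).
- exact: S'_log.
Qed.

(** The delta_log-structure S' on the extension ring of (A', M) lies over (A, M),
    so the universal property of S yields the second component of phi together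
    with its compatibilities, including the one with delta_log. *)
Lemma base_change_iso (dU : delta_structure U)
    (inld : forall a, inl (d' a) = dU (inl a))
    (inrd : forall t, inr (dlog_delta S t) = dU (inr t)) :
  exists phi : {rmorphism U -> ext_ring D' sMN},
    [/\ bijective phi,
        is_dlog_hom (base_change inrd) S' phi idfun
      & phi \o inl =1 ext_map D' sMN].
Proof.
have [S_alpha _ _] := S_ext.
have [S'_alpha _ [_ S'_delta _]] := S'_ext.
have [h [[h_alpha h_delta h_log] h_map]] :=
  ext_dlog_lift_exists p_prime dl_ext S_ext base_change_ext_hom p_rad.
have [phi phi_inl phi_inr] :
  exists2 phi : {rmorphism U -> ext_ring D' sMN},
    forall a, phi (inl a) = ext_map D' sMN a & forall t, phi (inr t) = h t.
  by apply: tensor_lift_exists => a; apply: esym (h_map a).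
have inlr a : inl (f a) = inr (ext_map D sMN a).
  exact: (@tensor_balanced _ _ _ f (ext_map D sMN) a).
(* psi will be the inverse of phi. *)
have [psi psi_map psi_alpha] :
  exists2 psi : {rmorphism ext_ring D' sMN -> U},
    forall a, psi (ext_map D' sMN a) = inl a &
    forall n, psi (ext_alpha D' sMN n) = prelog_comp inr (ext_alpha D sMN) n.
  apply: ext_ring_lift_exists => m; apply: etrans (inlr (dlog_alpha D m)) _.
  exact: congr1 (ext_map_alpha D sMN m).
have phi_alpha n : phi (inr (ext_alpha D sMN n)) = ext_alpha D' sMN n.
  apply: etrans (phi_inr _) (etrans (congr1 h (esym (S_alpha n))) _).
  exact: etrans (h_alpha n) (S'_alpha n).
exists phi; split; last exact: phi_inl; last first.
  split=> [n|x|n].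
  - exact: etrans (phi_inr _) (h_alpha n).
  - pose u : {rmorphism U -> witt2 p_prime (ext_ring D' sMN)} :=
      witt2_map phi \o delta_section p_prime dU.
    pose v : {rmorphism U -> witt2 p_prime (ext_ring D' sMN)} :=
      delta_section p_prime (dlog_delta S') \o phi.
    suff /(congr1 snd) : u x = v x by [].
    move: x; apply: (tensor_ext (u := u) (v := v)) => [a|t]; congr pair.
      apply: etrans (congr1 phi (esym (inld a))) (etrans (phi_inl _) _).
      exact: etrans (S'_delta a) (congr1 _ (esym (phi_inl a))).
    apply: etrans (congr1 phi (esym (inrd t))) (etrans (phi_inr _) _).
    exact: etrans (h_delta t) (congr1 _ (esym (phi_inr t))).
  - exact: etrans (phi_inr _) (h_log n).
exists psi => x.
  apply: (@tensor_ext _ _ _ _ _ _ (psi \o phi) idfun) => [a|t].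
    exact: etrans (congr1 psi (phi_inl a)) (psi_map a).
  apply: (@ext_ring_ext _ _ _ _ _ _ _ (psi \o (phi \o inr)) inr) => [a|n].
    have phi_inlr := etrans (congr1 phi (esym (inlr a))) (phi_inl (f a)).
    exact: etrans (congr1 psi phi_inlr) (etrans (psi_map (f a)) (inlr a)).
  exact: etrans (congr1 psi (phi_alpha n)) (psi_alpha n).
apply: (@ext_ring_ext _ _ _ _ _ _ _ (phi \o psi) idfun) => [a|n].
  exact: etrans (congr1 phi (psi_map a)) (phi_inl a).
exact: etrans (congr1 phi (psi_alpha n)) (phi_alpha n).
Qed.

End BaseChangeIso.

(** * The proposition *)

Theorem proposition2p16 (p : nat) (p_prime : prime p)
    (A : zlocAlg p) (M : nmodType) (D : dlog_ring A M)
    (M_int : integral_monoid M) (p_rad : jacobson_radical (p%:R : A)) :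
  exists dl : gp M -> A,
  [/\ is_log_extension D dl,
      forall dl' : gp M -> A, is_log_extension D dl' -> dl' =1 dl
    & forall (N : addrClosed (gp M)) (sMN : forall m : M, to_gp m \in N),
      exists S : dlog_ring (ext_ring D sMN) (submonoid N),
      [/\ is_ext_dlog dl S,
          forall S' : dlog_ring (ext_ring D sMN) (submonoid N),
            is_ext_dlog dl S' -> dlog_delta S' =1 dlog_delta S,
          forall (B : zlocAlg p) (E : dlog_ring B (submonoid N))
                 (f : {rmorphism A -> B}),
            is_dlog_hom D E f (to_sub sMN) ->
            exists h : {rmorphism ext_ring D sMN -> B},
            [/\ is_dlog_hom S E h idfun,
                h \o ext_map D sMN =1 f
              & forall (h' : {rmorphism ext_ring D sMN -> B})
                       (g' : {additive submonoid N -> submonoid N}),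
                  is_dlog_hom S E h' g' ->
                  h' \o ext_map D sMN =1 f ->
                  g' \o to_sub sMN =1 to_sub sMN ->
                  h' =1 h /\ g' =1 idfun]
        & forall (A' : zlocAlg p) (d' : delta_structure A')
                 (f : {rmorphism A -> A'})
                 (fd : forall a, f (dlog_delta D a) = d' (f a)),
            jacobson_radical (p%:R : A') ->
            let D' := base_change fd in
            forall (dl' : gp M -> A')
                   (S' : dlog_ring (ext_ring D' sMN) (submonoid N)),
              is_log_extension D' dl' -> is_ext_dlog dl' S' ->
              let U := tensor_alg f (ext_map D sMN) in
              let inl : {rmorphism A' -> U} := tensor_inl f (ext_map D sMN) in
              let inr : {rmorphism ext_ring D sMN -> U} :=
                tensor_inr f (ext_map D sMN) in
              exists (dU : delta_structure U)
                     (inld : forall a, inl (d' a) = dU (inl a))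
                     (inrd : forall t, inr (dlog_delta S t) = dU (inr t)),
                (forall dU' : delta_structure U,
                   (forall a, inl (d' a) = dU' (inl a)) ->
                   (forall t, inr (dlog_delta S t) = dU' (inr t)) ->
                   dU' =1 dU) /\
                exists phi : {rmorphism U -> ext_ring D' sMN},
                [/\ bijective phi,
                    is_dlog_hom (base_change inrd) S' phi idfun
                  & phi \o inl =1 ext_map D' sMN]]].
Proof.
have [dl dl_ext] := log_extension_exists D p_rad.
exists dl; split=> [//|dl' dl'_ext|N sMN].
  exact: (log_extension_unique p_rad dl_ext dl'_ext).
have [S S_ext] := ext_dlog_exists p_prime sMN dl_ext.
exists S; split=> [|S' S'_ext|B E f f_hom|]; first exact: S_ext.
- exact: (ext_dlog_unique p_prime S_ext S'_ext).
- have [h [h_hom h_map]] :=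
    ext_dlog_lift_exists p_prime dl_ext S_ext f_hom p_rad.
  exists h; split=> [||h' g' h'_hom h'_map g'_sub].
  - exact: h_hom.
  - exact: h_map.
  - exact: (ext_dlog_lift_unique S_ext h_hom h_map h'_hom h'_map g'_sub).
move=> A' d' f fd _ D' dl' S' _ S'_ext U inl inr.
have [_ _ [_ S_delta _]] := S_ext.
have [dU [inld inrd]] := tensor_delta_exists p_prime fd S_delta.
exists dU, inld, inrd; split=> [dU' inld' inrd'|].
  apply: (tensor_delta_unique p_prime) => x.
    exact: etrans (esym (inld' x)) (inld x).
  exact: etrans (esym (inrd' x)) (inrd x).
exact: (base_change_iso p_prime p_rad dl_ext S_ext S'_ext).
Qed.
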